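(* Let $a>0$ and let \[ h(s)=\frac{a^2s^2}{(1-a)s^2+2s+1}. \] Define the family of real rational transfer functions $(F_N)_{N\in\mathbb{N}}$ recursively by \[ F_{N+1}(s)=\frac{F_N(s)+h(s)}{F_N(s)+h(s)+1},\qquad F_0(s)=0. \] Then \[ \sup_{N\in\mathbb{N}}\|F_N\|_\infty\le a . \]
   Context: For a transfer function $G$ (a function of the complex variable $s$), $\|G\|_\infty:=\sup_{s\in\mathbb{C}_+}|G(s)|$, where $\mathbb{C}_+$ denotes the open right half of the complex plane; the space $\mathscr{H}_\infty$ consists of the transfer functions analytic on $\mathbb{C}_+$ with finite such norm. *)

(* Defs.v *)
From HB Require Import structures.
From mathcomp Require Import all_boot all_order all_algebra.
From mathcomp Require Import fraction.
From mathcomp Require Import complex.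
Set Implicit Arguments. Unset Strict Implicit. Unset Printing Implicit Defensive.
Import Order.TTheory GRing.Theory Num.Theory.
Local Open Scope ring_scope.

Notation ratfun R := {fraction {poly R}}.
Notation "x %:F" := (@FracField.tofrac _ x).

Definition hfun (R : rcfType) (a : R) : ratfun R :=
  ((a ^+ 2) *: 'X^2)%:F / (((1 - a) *: 'X^2 + 2%:R *: 'X + 1))%:F.

Fixpoint Ffun (R : rcfType) (a : R) (N : nat) : ratfun R :=
  match N with
  | 0 => 0
  | N'.+1 => (Ffun a N' + hfun a) / (Ffun a N' + hfun a + 1)
  end.

Definition cpeval (R : rcfType) (p : {poly R}) (s : R[i]) : R[i] :=
  (map_poly (fun x : R => (x%:C)%C) p).[s].

Definition rhp (R : rcfType) (s : R[i]) : Prop := 0 < complex.Re s.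

(* ||F||_oo <= c for a rational function F: for every representation
   F = n/d (d a nonzero polynomial), |n(s)/d(s)| <= c at every point s of the
   open right half plane where d(s) <> 0.  Since d has finitely many zeros,
   this says F has no poles in C_+ (singularities there are removable and
   bounded) and sup_{s in C_+} |F(s)| <= c, i.e. F in H_oo with norm <= c. *)
Definition Hinf_le (R : rcfType) (F : ratfun R) (c : R) : Prop :=
  forall (n d : {poly R}), d != 0 -> F = n%:F / d%:F ->
  forall s : R[i], rhp s -> cpeval d s != 0 ->
  `|cpeval n s / cpeval d s| <= (c%:C)%C.

(* Main.v *)
(** Write [w = 1 + 1/s] and [D = w^2 - a], so that [h = a^2 / D] and [Re w > 1]
    on the right half plane.  Putting [F = a A / Q], the recursion becomes the
    linear one [A' = D A + a Q], [Q' = a A' + D Q].  For each fixed [w] the disc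
    of values [A / Q] having the segment from [0] to [conj w / |w|] as a
    diameter, i.e. [|w| |A|^2 <= Re (w A conj Q)], contains the starting value
    [0], is contained in the unit disc, and is invariant under the recursion. *)
Require Import Defs.
From HB Require Import structures.
From mathcomp Require Import all_boot all_order all_algebra.
From mathcomp Require Import fraction complex ring.
Import Order.TTheory GRing.Theory Num.Theory.
Local Open Scope ring_scope.

(* The factor [b] clears the denominators of [w]: the recursion is homogeneous,
   so it may be run with [d = s^2 D] and [b = s^2], which are polynomials. *)
Definition chain_step {T : comNzRingType} (a b d : T) (p : T * T) : T * T :=
  let A := d * p.1 + a * b * p.2 in (A, a * A + d * p.2).

Definition chain {T : comNzRingType} (a b d : T) (N : nat) : T * T :=
  iter N (chain_step a b d) (0, 1).

Lemma chainS (T : comNzRingType) (a b d : T) N :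
  chain a b d N.+1 = chain_step a b d (chain a b d N).
Proof. by []. Qed.

Lemma rmorph_chain (T U : comNzRingType) (f : {rmorphism T -> U}) (a b d : T) N :
  chain (f a) (f b) (f d) N = (f (chain a b d N).1, f (chain a b d N).2).
Proof.
elim: N => [|N]; first by rewrite /chain /= rmorph0 rmorph1.
by rewrite !chainS => ->; rewrite /chain_step /= !(rmorphD, rmorphM).
Qed.

(** Both sums have denominator [Q * d], which cancels when one is divided by the other and leaves
    [c * q.1 / q.2]. *)
Lemma chain_step_ratio (K : fieldType) (A Q d x c : K) : Q != 0 -> d != 0 ->
  let q := chain_step c (x * x) d (A, Q) in
  c * A / Q + c * c * (x * x) / d = c * q.1 / (Q * d) /\
  c * A / Q + c * c * (x * x) / d + 1 = q.2 / (Q * d).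
Proof. by move=> Q0 d0; split=> /=; field; rewrite Q0 d0. Qed.

Section Disc.
Variable C : numClosedFieldType.
Implicit Types a b w A Q : C.

Definition in_disc w (p : C * C) : Prop :=
  `|w| * `|p.1| ^+ 2 <= 'Re (w * p.1 * p.2^*).

(** Applying [Re z <= |z|] to [z = w A conj Q] gives [|w| |A|^2 <= |w| |A| |Q|], from which
    [|w| |A|] cancels unless [A = 0]. *)
Lemma in_disc_le w p : w != 0 -> in_disc w p -> `|p.1| <= `|p.2|.
Proof.
move=> w0 h; have := le_trans h (leif_Re_Creal _).
rewrite !normrM norm_conjC expr2 -mulrA ler_pM2l ?normr_gt0 //.
have [->|A0] := eqVneq p.1 0; first by rewrite normr0.
by rewrite ler_pM2l ?normr_gt0.
Qed.

(* Certificate of invariance: the old slack, plus a square, plus a term which is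
   nonnegative because [1 <= Re w <= |w|]. *)
Lemma disc_step_identity a w A Q (D := w ^+ 2 - a) (A' := D * A + a * Q)
    (Q' := a * A' + D * Q) : a \is Num.real ->
  a * 'Re w * ('Re (w * A' * Q'^*) - `|w| * `|A'| ^+ 2) =
  a * 'Re w * `|D| ^+ 2 * ('Re (w * A * Q^*) - `|w| * `|A| ^+ 2)
  + `|a * 'Re w * (D * A) - (`|w| - a * 'Re w) * (a * Q)| ^+ 2
  + a ^+ 2 * (`|w| ^+ 2 * ('Re w ^+ 2 - 1) + a * 'Re w * (`|w| - 'Re w))
    * `|Q| ^+ 2.
Proof.
move=> ra.
have ca : a^* = a by apply: conj_Creal.
have cr : (`|w|)^* = `|w| by apply/conj_Creal/normr_real.
have cR : ('Re w)^* = 'Re w by apply/conj_Creal/Creal_Re.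
have hw : `|w| ^+ 2 = w * w^* by rewrite normCK.
(* The modulus of [w] also occurs to odd powers, so it stays an atom, tied to [w] and its conjugate
   by [hw] alone. *)
rewrite !(normCK A', normCK D, normCK A, normCK Q, normCK (_ - _)).
rewrite /Q' /A' /D.
rewrite !(rmorphD, rmorphN, rmorphM, rmorphXn) /= ?conjCK ca cr cR.
rewrite !ReE !(rmorphD, rmorphN, rmorphM, rmorphXn) /= ?conjCK ca.
by field: hw.
Qed.

Lemma in_disc_step a w p : 0 < a -> 1 < 'Re w ->
  in_disc w p -> in_disc w (chain_step a 1 (w ^+ 2 - a) p).
Proof.
move=> a0 w1; rewrite /in_disc /chain_step /= mulr1 -subr_ge0 => h.
rewrite -subr_ge0.
have al0 : 0 < 'Re w by apply: lt_trans w1.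
have aal : 0 < a * 'Re w by rewrite mulr_gt0.
rewrite -(pmulr_rge0 _ aal) disc_step_identity ?gtr0_real //.
rewrite !addr_ge0 ?exprn_ge0 //.
  by rewrite mulr_ge0 // mulr_ge0 ?exprn_ge0 // ltW.
rewrite mulr_ge0 ?exprn_ge0 // mulr_ge0 ?exprn_ge0 ?(ltW a0) //.
rewrite addr_ge0 // mulr_ge0 ?exprn_ge0 ?(ltW aal) //.
  by rewrite subr_ge0 exprn_ege1 // ltW.
by rewrite subr_ge0 leif_Re_Creal.
Qed.

Lemma chain_in_disc a w N (p := chain a 1 (w ^+ 2 - a) N) :
  0 < a -> 1 < 'Re w -> in_disc w p /\ p.2 != 0.
Proof.
move=> a0 w1; have w0 : w != 0.
  by apply: contraTneq w1 => ->; rewrite raddf0 ltr10.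
rewrite {}/p; elim: N => [|N []].
  by rewrite /in_disc /= normr0 expr0n /= !mulr0 mul0r raddf0 oner_neq0.
rewrite chainS; move: (chain _ _ _ N) => [A Q] /in_disc_step h /= Q0.
split; first exact: h.
(* If [Q' = 0], the disc bound forces [A' = 0]; then [Q' = D Q] gives [D = 0], so [A' = a Q] is
   nonzero, a contradiction. *)
apply/eqP => Q1; have := in_disc_le _ _ w0 (h _ a0 w1).
rewrite /chain_step /= in Q1 *; rewrite Q1 normr0 normr_le0 => /eqP A1.
move: Q1; rewrite A1 mulr0 add0r => /eqP.
rewrite mulf_eq0 (negbTE Q0) orbF => /eqP D0.
by move/eqP: A1; rewrite D0 mul0r add0r mulr1 mulf_eq0 (negbTE Q0) gt_eqF.
Qed.

Lemma chain_scale a b d N :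
  chain a b (b * d) N = (b ^+ N * (chain a 1 d N).1, b ^+ N * (chain a 1 d N).2).
Proof.
elim: N => [|N]; first by rewrite /chain /= expr0 !mul1r.
by rewrite !chainS => ->; rewrite /chain_step /= exprS; congr pair; ring.
Qed.

Lemma chain_bound a b w N (p := chain a b (b * (w ^+ 2 - a)) N) :
  0 < a -> 1 < 'Re w -> b != 0 -> p.2 != 0 /\ `|p.1| <= `|p.2|.
Proof.
move=> a0 w1 b0; have [hp p0] := chain_in_disc a w N a0 w1.
have w0 : w != 0 by apply: contraTneq w1 => ->; rewrite raddf0 ltr10.
rewrite /p chain_scale /= mulf_neq0 ?expf_neq0 //; split=> //.
by rewrite !normrM ler_wpM2l // (in_disc_le w _ w0 hp).
Qed.

End Disc.

Section RationalChain.
Variables (R : rcfType) (a : R).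
Hypothesis a_gt0 : 0 < a.

Definition hden : {poly R} := (1 - a) *: 'X^2 + 2%:R *: 'X + 1.

Definition pchain N : {poly R} * {poly R} := chain a%:P 'X^2 hden N.

Lemma hden_neq0 : hden != 0.
Proof.
apply/eqP => /(congr1 (fun p : {poly R} => p.[0])) /eqP.
by rewrite /hden !hornerE /= !mulr0 add0r oner_eq0.
Qed.

(** Evaluation as a bundled ring morphism lets [rmorph_chain] carry the polynomial chain to the
    complex one. *)
Lemma cpeval_rmorph (s : R[i]) :
  {f : {rmorphism {poly R} -> R[i]} | f =1 (fun p => cpeval p s)}.
Proof. by exists (horner_eval s \o map_poly (real_complex R)). Qed.

Lemma pchain_bound N (s : R[i]) : rhp s ->
  cpeval (pchain N).2 s != 0 /\
  `|cpeval (pchain N).1 s| <= `|cpeval (pchain N).2 s|.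
Proof.
move=> hs; have [f fE] := cpeval_rmorph s.
have s_gt0 : 0 < 'Re s by rewrite -complexRe ltcR.
have s0 : s != 0 by apply: contraTneq s_gt0 => ->; rewrite raddf0 ltxx.
have fX : f 'X = s by rewrite fE /cpeval map_polyX hornerX.
have fC c : f c%:P = (c%:C)%C by rewrite fE /cpeval map_polyC hornerC.
(* Here [(1 - a) s^2 + 2 s + 1 = (s + 1)^2 - a s^2], which is [b (w^2 - a)] for [b = s^2] and
   [w = 1 + 1/s]. *)
have fd : f hden = s ^+ 2 * ((1 + s^-1) ^+ 2 - (a%:C)%C).
  rewrite /hden -!mul_polyC polyCB polyC1 polyC_natr.
  rewrite !(rmorphD, rmorphN, rmorphM, rmorphXn, rmorph1, rmorph_nat) /= fX fC.
  by field.
have := rmorph_chain _ _ f a%:P 'X^2 hden N.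
rewrite rmorphXn /= fX fC fd -/(pchain N) !fE => E.
have := chain_bound R[i] (a%:C)%C (s ^+ 2) (1 + s^-1) N.
rewrite E /=; apply; rewrite ?ltcR ?expf_neq0 //.
(* [Re w > 1] because [Re (1/s) = Re s / |s|^2 > 0]. *)
rewrite raddfD /= (Creal_ReP _ (rpred1 _)) ltrDl.
by rewrite ReV divr_gt0 // exprn_gt0 // normr_gt0.
Qed.

Lemma pchain2_neq0 N : (pchain N).2 != 0.
Proof.
have [|+ _] := pchain_bound N 1; first by rewrite /rhp ltr01.
by apply: contraNneq => ->; rewrite /cpeval map_poly0 horner0.
Qed.

Lemma Ffun_hfun N (F := Ffun a N) :
    F = (a%:P * (pchain N).1)%:F / (pchain N).2%:F ->
  F + hfun a = (a%:P * (pchain N.+1).1)%:F / ((pchain N).2 * hden)%:F /\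
  F + hfun a + 1 = (pchain N.+1).2%:F / ((pchain N).2 * hden)%:F.
Proof.
move=> FE; have Q0 := pchain2_neq0 N; have d0 := hden_neq0.
rewrite -tofrac_eq0 in Q0; rewrite -tofrac_eq0 in d0.
rewrite FE /hfun -/hden -mul_polyC rmorphXn /=.
move: hden d0 => d d0; rewrite !(tofracD, tofracM, tofracXn).
move: (_ N).1%:F (_ N).2%:F d%:F 'X%:F a%:P%:F Q0 d0 => A Q D x c Q0 D0.
have [] := chain_step_ratio _ A Q D x c Q0 D0.
by rewrite /chain_step /fst /snd => -> ->.
Qed.

Lemma FfunE N : Ffun a N = (a%:P * (pchain N).1)%:F / (pchain N).2%:F.
Proof.
elim: N => [|N IH]; first by rewrite /= mulr0 tofrac0 mul0r.
have [/= -> ->] := Ffun_hfun N IH.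
have := mulf_neq0 (pchain2_neq0 N) hden_neq0; rewrite -tofrac_eq0 => d0.
by rewrite invf_div mulrA divfK.
Qed.

(** Division by zero returns zero in [ratfun]; this certifies that the recursive quotients in [Ffun]
    are genuine. *)
Lemma Ffun_hfun_neq0 N : Ffun a N + hfun a + 1 != 0.
Proof.
have [_ ->] := Ffun_hfun N (FfunE N).
by rewrite mulf_neq0 ?invr_eq0 ?tofrac_eq0 ?mulf_neq0 ?pchain2_neq0 ?hden_neq0.
Qed.

Lemma Ffun_Hinf_le N : Hinf_le (Ffun a N) a.
Proof.
move=> n d d0; rewrite FfunE => E s hs ds0.
have Q0 := pchain2_neq0 N; have [Qs0 AQ] := pchain_bound N s hs.
(* Cross-multiplying turns equality of fractions into a polynomial identity; at [s] both
   denominators are nonzero, so the two quotients have the same value there. *)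
have {}E : a%:P * (pchain N).1 * d = n * (pchain N).2.
  apply/eqP; rewrite -tofrac_eq !tofracM; apply/eqP.
  by move/eqP: E; rewrite eqr_div ?tofrac_eq0 // tofracM => /eqP.
have [f fE] := cpeval_rmorph s.
have := congr1 f E; rewrite !rmorphM !fE {1}/cpeval map_polyC hornerC /=.
move/eqP; rewrite -eqr_div // => /eqP <-.
rewrite normrM normfV ler_pdivrMr ?normr_gt0 // normrM.
by rewrite ger0_norm ?ler_wpM2l // lecR ltW.
Qed.

End RationalChain.

Theorem theorem1 (R : rcfType) (a : R) (ha : 0 < a) :
  (forall N : nat, Ffun a N + hfun a + 1 != 0) /\
  (forall N : nat, Hinf_le (Ffun a N) a).
Proof. by split=> N; [apply: Ffun_hfun_neq0 | apply: Ffun_Hinf_le]. Qed.
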